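(* There is a function $h:(0,\infty)\to\mathbb{R}$ with $h(\varepsilon)\to 0$ as $\varepsilon\to 0^+$ such that the following holds. For every $\varepsilon>0$ and every election $(V,C,\succ_V)$ (with any number of voters and any number of candidates), there is a set $S\subseteq C$ with $$|S|\le (1+h(\varepsilon))\,\frac{\pi}{8\varepsilon^2}$$ that is a $(\tfrac12-\varepsilon)$-dominating set. Moreover, $S$ can be chosen so that there is in addition a probability distribution $D$ over $S$ such that $$\max_{a\in C}\ \mathbb{E}_{b\sim D}\big[\tfrac1n|a\succ b|\big]\le \tfrac12+\varepsilon .$$
   Context: An election is a tuple $(V,C,\succ_V)$, where $V$ is a finite nonempty set of $n$ voters, $C$ is a finite nonempty set of $m$ candidates, and $\succ_V=\{\succ_v\}_{v\in V}$ assigns to each voter $v$ a strict linear order $\succ_v$ on $C$; $a\succ_v b$ means that voter $v$ prefers candidate $a$ to candidate $b$. For $a,b\in C$, $$\tfrac1n|a\succ b| := \frac1n\sum_{v\in V}\mathds{1}[a\succ_v b]$$ is the fraction of voters that prefer $a$ over $b$ (in particular it equals $0$ when $a=b$). For a real number $\alpha$, a set $S\subseteq C$ of candidates is an $\alpha$-dominating set if for every candidate $a\in C\setminus S$ there exists $b\in S$ such that $\tfrac1n|b\succ a|\ge\alpha$. *)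

(* Defs.v *)
From mathcomp Require Import all_boot all_order all_algebra.
From mathcomp Require Import reals.

Set Implicit Arguments.
Unset Strict Implicit.
Unset Printing Implicit Defensive.

Import Order.TTheory GRing.Theory Num.Theory.
Local Open Scope ring_scope.

Definition strict_linear_order (T : eqType) (r : rel T) : Prop :=
  [/\ irreflexive r, transitive r & forall a b, a != b -> r a b || r b a].

(* [prefers v a b] means that voter [v] prefers candidate [a] to candidate
   [b]. *)
Record election := Election {
  voter : finType;
  candidate : finType;
  voter_gt0 : (0 < #|voter|)%N;
  candidate_gt0 : (0 < #|candidate|)%N;
  prefers : voter -> rel candidate;
  prefersP : forall v, strict_linear_order (prefers v) }.

Definition pref_frac (R : realType) (E : election) (a b : candidate E) : R :=
  #|voter E|%:R^-1 * \sum_(v : voter E) (prefers v a b)%:R.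

Definition dominating_set (R : realType) (E : election) (alpha : R)
    (S : {set candidate E}) : Prop :=
  forall a, a \notin S -> exists2 b, b \in S & alpha <= pref_frac R b a.

(* A probability distribution over the finite set [S] is given by its mass
   function, extended by 0 to the whole type. *)
Definition is_distr_over (R : realType) (T : finType) (S : {set T})
    (D : {ffun T -> R}) : Prop :=
  [/\ forall b, 0 <= D b, forall b, b \notin S -> D b = 0 &
      \sum_(b in S) D b = 1].

Definition expectation_over (R : realType) (T : finType) (S : {set T})
    (D : {ffun T -> R}) (f : T -> R) : R :=
  \sum_(b in S) D b * f b.

(* Main.v *)
Require Import Defs.
From mathcomp Require Import all_boot all_order all_algebra perm.
From mathcomp Require Import zify ring lra.
From mathcomp Require Import all_classical reals ereal topology normedtype.
From mathcomp Require Import sequences measure measurable_realfun.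
From mathcomp Require Import lebesgue_measure lebesgue_integral exp trigo.
From mathcomp Require Import gauss_integral.

(* By regret matching there are candidates c_1, ..., c_N against which every
   candidate a obtains on average at most 1/2 + 1/k of the votes. Sample k of
   them uniformly with replacement. For a fixed voter, the fraction of the
   sample that a beats exceeds the fraction of c_1, ..., c_N that a beats by at
   most a one-sided Kolmogorov-Smirnov statistic, which does not depend on a and
   whose mean is of order sqrt(pi / (8 k)). Averaging over the voters, some
   sample is good for all a at once, and k ~ pi / (8 eps^2) suffices.

   Up to rounding to k blocks, the statistic is 1/k times the maximal excess
   max_j (#{t | f t < j} - j) of a uniformly random f : [k] -> [k]. Spitzer's
   identity turns its mean into a sum of mean binomial deviations, which
   De Moivre's formula evaluates; the Abel-Cauchy identity then turns the result
   into half the sum of k^_i / k^i over i, and this is compared with the Gaussian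
   integral. *)

Set Implicit Arguments.
Unset Strict Implicit.
Unset Printing Implicit Defensive.

Import Order.TTheory GRing.Theory Num.Theory.
Import numFieldNormedType.Exports.
Local Open Scope ring_scope.

(** * The Abel-Cauchy identity *)

Section CauchyAbel.

Local Open Scope nat_scope.

(** One of Abel's generalised binomial sums; at [x = 0] the convention [0 ^ 0 = 1] enters. *)
Definition abel_sum n x y :=
  \sum_(j < n.+1) 'C(n, j) * ((x + j) ^ j * (y + (n - j)) ^ (n - j)).

Definition abel_sum1 n x y :=
  \sum_(j < n.+1) 'C(n, j) * ((x + j) ^ j.+1 * (y + (n - j)) ^ (n - j)).

(* [abel_sum n x y] depends only on [s = x + y + n]: it is the first component;
   the second one is [abel_sum1 n x.+1 y - abel_sum1 n x y.+1] for
   [s = x + y + n + 1]. *)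
Fixpoint abel_val n s : nat * nat :=
  if n is m.+1 then
    let: (a, d) := abel_val m s in (s * a + d, s * a + d + m.+1 * d)
  else (1, 1).

Lemma sum_bin_recr n (F : nat -> nat) :
  \sum_(j < n.+2) 'C(n.+1, j) * F j =
  \sum_(j < n.+1) 'C(n, j) * F j + \sum_(j < n.+1) 'C(n, j) * F j.+1.
Proof.
rewrite big_ord_recl bin0 [in RHS]big_ord_recl bin0 -addnA; congr (_ + _).
under eq_bigr do rewrite lift0 binS mulnDl.
rewrite big_split /= [in LHS]addnC addnC; congr (_ + _).
by rewrite big_ord_recr /= bin_small // mul0n addn0.
Qed.

(** Split one factor [x + j]; for positive [j] the part with [j] is absorbed by
    [j * 'C(n.+1, j) = n.+1 * 'C(n, j.-1)]. *)
Lemma abel_sum1E n x y :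
  abel_sum1 n.+1 x y =
  x * abel_sum n.+1 x y + n.+1 * abel_sum1 n x.+1 y.
Proof.
rewrite /abel_sum1 /abel_sum.
under eq_bigr do rewrite expnS mulnDl mulnDl mulnDr.
rewrite big_split /= big_distrr /=; congr (_ + _).
  by apply: eq_bigr => j _; ring.
rewrite big_ord_recl /= mul0n mul0n muln0 add0n big_distrr /=.
apply: eq_bigr => j _; rewrite /bump /= add1n subSS addnS -addSn.
have E := mul_bin_diag n.+1 j.
by rewrite [in RHS]mulnA E; ring.
Qed.

(** After Pascal's rule, one factor [y + (n.+1 - j)] is [(x + y + n.+1) - (x + j)]; the negative
    part is moved to the left. *)
Lemma abel_sumS n x y :
  abel_sum n.+1 x y + abel_sum1 n x y.+1 =
  (x + y + n.+1) * abel_sum n x y.+1 + abel_sum1 n x.+1 y.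
Proof.
rewrite /abel_sum /abel_sum1 (sum_bin_recr n
  (fun j => (x + j) ^ j * (y + (n.+1 - j)) ^ (n.+1 - j))) big_distrr /=.
rewrite addnAC -big_split /=; congr (_ + _).
  apply: eq_bigr => j _; have jn : j <= n by rewrite -ltnS.
  rewrite subSn // !expnS addSn addnS.
  have -> : x + y + n.+1 = (x + j) + (y + (n - j)).+1 by lia.
  ring.
by apply: eq_bigr => j _; rewrite subSS addnS addSn.
Qed.

(** One induction for both claims: [abel_sumS] gets the next sum from the previous sum and
    difference, [abel_sum1E] the next difference from the next sum and the previous difference. *)
Lemma abel_sum_val n x y :
  abel_sum n x y = (abel_val n (x + y + n)).1 /\
  abel_sum1 n x.+1 y =
    abel_sum1 n x y.+1 + (abel_val n (x + y + n).+1).2.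
Proof.
elim: n x y => [|n IH] x y.
  rewrite /abel_sum /abel_sum1 !big_ord1 /= !bin0 !expn0 !expn1; lia.
have A x' y' : abel_sum n.+1 x' y' = (abel_val n.+1 (x' + y' + n.+1)).1.
  apply/eqP; rewrite -(eqn_add2r (abel_sum1 n x' y'.+1)); apply/eqP.
  rewrite abel_sumS (IH x' y').2 (IH x' y'.+1).1 ?addnS ?addSn ?addnS /=.
  by case: (abel_val n _) => a d /=; ring.
split; first exact: A.
rewrite !abel_sum1E !A (IH x.+1 y).2 !addSn !addnS.
rewrite [LHS]/= [RHS]/=.
by case: (abel_val n _) => a d /=; ring.
Qed.

(** Eliminates the second component, so that the recursion unrolls into falling factorials. *)
Lemma abel_valS n s : (abel_val n.+1 s).1 = s ^ n.+1 + n.+1 * (abel_val n s).1.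
Proof.
elim: n => [|n IH] /=; first by rewrite expn1; lia.
move: IH => /=; case: (abel_val n s) => a d /= IH.
rewrite {1}IH; have -> : s * (s ^ n.+1 + n.+1 * a) = s ^ n.+2 + n.+1 * (s * a).
  by rewrite (expnS s n.+1); ring.
ring.
Qed.

Lemma abel_valE n s : (abel_val n s).1 = \sum_(i < n.+1) n ^_ i * s ^ (n - i).
Proof.
elim: n => [|n IH]; first by rewrite big_ord1.
rewrite abel_valS IH [in RHS]big_ord_recl ffactn0 mul1n subn0; congr (_ + _).
rewrite big_distrr; apply: eq_bigr => i _ /=.
by rewrite /bump /= add1n ffactSS subSS mulnA.
Qed.

(** The case [x = y = 0]. Divided by [k ^ k], the left side sums the probabilities that a binomial
    variable with parameters [k] and [j / k] equals its mean [j]. *)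
Lemma sum_binomial_weights k :
  \sum_(j < k.+1) 'C(k, j) * (j ^ j * (k - j) ^ (k - j)) =
  \sum_(i < k.+1) k ^_ i * k ^ (k - i).
Proof.
rewrite -abel_valE -[k in abel_val _ k](add0n k) -[in 0 + k](addn0 0).
rewrite -(abel_sum_val k 0 0).1.
by apply: eq_bigr => j _; rewrite !add0n.
Qed.

End CauchyAbel.

(** * Spitzer's identity *)

Section Spitzer.

Local Open Scope nat_scope.

Variables (I : finType) (k : nat).
Implicit Type f : {ffun I -> 'I_k}.

Definition count_below f j := #|[set t | f t < j]|.

(** Truncated subtraction is harmless: the term [j = 0] is 0 anyway. *)
Definition max_excess n f := \max_(j < n.+1) (count_below f j - j).

Lemma max_excess_ge f n j : j <= n -> count_below f j <= j + max_excess n f.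
Proof.
move=> jn; rewrite -leq_subLR -ltnS in jn *.
exact: (@leq_bigmax _ (fun j : 'I_n.+1 => count_below f j - j) (Ordinal jn)).
Qed.

Lemma max_excess_leP f n m :
  reflect (forall j, j <= n -> count_below f j <= j + m) (max_excess n f <= m).
Proof.
apply: (iffP idP) => [le_m j jn|H].
  by apply: leq_trans (max_excess_ge f jn) _; rewrite leq_add2l.
by apply/bigmax_leqP => j _; rewrite leq_subLR H // -ltnS.
Qed.

Lemma max_excessS f n :
  count_below f n.+1 <= n.+1 -> max_excess n.+1 f = max_excess n f.
Proof.
move=> le_n; apply/eqP; rewrite eqn_leq; apply/andP; split; apply/max_excess_leP.
  move=> j; rewrite leq_eqVlt => /orP[/eqP ->|]; last by rewrite ltnS => /max_excess_ge.
  exact: leq_trans le_n (leq_addr _ _).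
by move=> j jn; apply: max_excess_ge; rewrite (leq_trans jn).
Qed.

Definition permute (s : {perm 'I_k}) f : {ffun I -> 'I_k} := [ffun t => s (f t)].

Lemma sum_permute s (F : {ffun I -> 'I_k} -> nat) :
  \sum_f F (permute s f) = \sum_f F f.
Proof.
rewrite [RHS](reindex (permute s)) //=; exists (permute s^-1) => f _;
  by apply/ffunP => t; rewrite !ffunE ?permK ?permKV.
Qed.

Definition fiber f i := #|[set t | f t == i]|.

Lemma sum_fiber f n : n <= k -> \sum_(i < k | i < n) fiber f i = count_below f n.
Proof.
move=> nk; rewrite /count_below -sum1_card.
rewrite (partition_big f (fun i : 'I_k => i < n)) /=; last first.
  by move=> t; rewrite inE.
apply: eq_bigr => i iN; rewrite /fiber -sum1_card; apply: eq_bigl => t.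
by rewrite !inE; case: eqP => [->|]; rewrite ?iN ?andbF.
Qed.

Lemma count_below_permute (s : {perm 'I_k}) f n :
  (forall i, (s i < n) = (i < n)) -> count_below (permute s f) n = count_below f n.
Proof. by move=> sn; apply: eq_card => t; rewrite !inE ffunE sn. Qed.

(** The condition on [f] is invariant under permuting the first [n.+1] slots, so each of them
    carries the same total. *)
Lemma sum_fiber_excess n (i0 : 'I_k) : i0 = 0 :> nat -> n.+1 <= k ->
  n.+1 * \sum_(f | n.+1 < count_below f n.+1) fiber f i0 =
  \sum_(f | n.+1 < count_below f n.+1) count_below f n.+1.
Proof.
move=> i00 nk.
under [RHS]eq_bigr => f _ do rewrite -(sum_fiber f nk).
rewrite exchange_big /=.
transitivity (\sum_(i < k | i < n.+1)
  \sum_(f | n.+1 < count_below f n.+1) fiber f i0).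
  rewrite sum_nat_const; congr (_ * _).
  rewrite -sum1_card -(big_ord_widen _ (fun=> 1)) //.
  by rewrite sum_nat_const card_ord muln1.
apply: eq_bigr => i iN.
rewrite big_mkcond /= -(sum_permute (tperm i0 i)) -big_mkcond /=.
have sn (j : 'I_k) : (tperm i0 i j < n.+1) = (j < n.+1).
  by case: tpermP => [->|->|] //; rewrite i00 iN.
apply: eq_big => f; first by rewrite count_below_permute.
move=> _; apply: eq_card => t; rewrite !inE ffunE.
by rewrite -{2}(tpermR i0 i) (inj_eq perm_inj).
Qed.

(* The cyclic shift [i |-> i - 1] of the slots [0, ..., n]. *)
Definition shift_fun n (nk : n < k) (i : 'I_k) : 'I_k :=
  if i == 0 :> nat then Ordinal nk
  else if i < n.+1 then Ordinal (leq_ltn_trans (leq_pred i) (ltn_ord i)) else i.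

Lemma shift_fun_inj n (nk : n < k) : injective (shift_fun nk).
Proof.
move=> i j; rewrite /shift_fun => E; apply: val_inj; move: E => /(congr1 val) /=.
have [->|i0] := eqVneq (i : nat) 0; have [->|j0] := eqVneq (j : nat) 0;
  do ?case: ifP => ?; rewrite /=; lia.
Qed.

(** Moving slot 0 behind slot [n] removes its fiber from the prefix counts and lowers the indices by
    one. The excess at [n.+1] is positive, so leaving out the index 0 does not change the maximum
    for [f]. *)
Lemma max_excess_shift n (nk : n < k) (i0 : 'I_k) f : i0 = 0 :> nat ->
  n.+1 < count_below f n.+1 ->
  (max_excess n.+1 f).+1 =
    fiber f i0 + max_excess n (permute (perm (@shift_fun_inj n nk)) f).
Proof.
move=> i00; set g := permute _ f => big.
have cg j : j <= n -> fiber f i0 + count_below g j = count_below f j.+1.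
  move=> jn.
  rewrite /count_below /fiber -[RHS](cardsID [set t | f t == i0]).
  congr (_ + _); apply: eq_card => t; rewrite !inE.
    by case: eqP => [->|]; rewrite ?i00 // andbF.
  rewrite ffunE permE /shift_fun -val_eqE /= i00.
  by have [->|t0] := eqVneq (f t : nat) 0; do ?case: ifP => ?; rewrite /=; lia.
have c1 : fiber f i0 = count_below f 1.
  apply: eq_card => t; rewrite !inE -val_eqE /= i00; lia.
apply/eqP; rewrite eqn_leq; apply/andP; split.
  (* Ensures that the predecessor taken below is not truncated. *)
  have b : n.+1 < fiber f i0 + (n + max_excess n g).
    by rewrite (leq_trans big) // -cg // leq_add2l max_excess_ge.
  suff : max_excess n.+1 f <= (fiber f i0 + max_excess n g).-1 by lia.
  apply/max_excess_leP => -[|j] jn.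
    by rewrite /count_below (eq_card0 (A := mem [set t | f t < 0])) // => t; rewrite inE.
  have := max_excess_ge g (jn : j <= n); rewrite -cg //; lia.
have M1 : count_below f 1 <= 1 + max_excess n.+1 f by apply: max_excess_ge.
suff : max_excess n g <= (max_excess n.+1 f).+1 - fiber f i0 by lia.
apply/max_excess_leP => j jn.
have := @max_excess_ge f n.+1 j.+1 jn; rewrite -cg //; lia.
Qed.

(* Kac's proof of Spitzer's identity: if the last partial sum is nonpositive it
   does not affect the maximum; otherwise the maximum is the first increment
   plus a maximum over the remaining ones, and cyclic exchangeability makes the
   first increment contribute [1/(n+1)] of the last partial sum on average. *)
Lemma sum_max_excessS n : n < k ->
  n.+1 * \sum_f max_excess n.+1 f =
  n.+1 * \sum_f max_excess n f + \sum_f (count_below f n.+1 - n.+1).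
Proof.
move=> nk; pose i0 := Ordinal (leq_ltn_trans (leq0n n) nk).
pose P f := n.+1 < count_below f n.+1.
set s := perm (@shift_fun_inj n nk).
have Ps f : P (permute s f) = P f.
  rewrite /P count_below_permute // => i; rewrite permE /shift_fun.
  by have [->|i1] := eqVneq (i : nat) 0; do ?case: ifP => ?; rewrite /=; lia.
rewrite [\sum_f max_excess n.+1 f](bigID P) [\sum_f max_excess n f](bigID P).
rewrite [\sum_f (_ - _)](bigID P) /= !mulnDr.
have -> : \sum_(f | ~~ P f) (count_below f n.+1 - n.+1) = 0.
  by apply: big1 => f; rewrite /P -leqNgt => /eqP.
rewrite addn0 addnAC; congr (_ + _); last first.
  by congr (_ * _); apply: eq_bigr => f; rewrite /P -leqNgt => /max_excessS.
have H : \sum_(f | P f) (max_excess n.+1 f).+1 =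
    \sum_(f | P f) fiber f i0 + \sum_(f | P f) max_excess n f.
  rewrite [in X in _ = _ + X]big_mkcond /= -(sum_permute s) -big_mkcond /=.
  rewrite (eq_bigl _ _ Ps) -big_split /=; apply: eq_bigr => f Pf.
  exact: max_excess_shift.
have E : n.+1 * \sum_(f | P f) (max_excess n.+1 f).+1 =
    \sum_(f | P f) count_below f n.+1 + n.+1 * \sum_(f | P f) max_excess n f.
  by rewrite H mulnDr sum_fiber_excess.
have S1 : \sum_(f | P f) (max_excess n.+1 f).+1 =
    \sum_(f | P f) max_excess n.+1 f + \sum_(f | P f) 1.
  by rewrite -big_split /=; apply: eq_bigr => f _; rewrite addn1.
have S2 : \sum_(f | P f) count_below f n.+1 =
    \sum_(f | P f) (count_below f n.+1 - n.+1) + n.+1 * \sum_(f | P f) 1.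
  rewrite big_distrr -big_split /=; apply: eq_bigr => f Pf.
  by rewrite muln1 subnK // ltnW.
by move: E; rewrite S1 S2 !mulnDr addnAC => /addIn ->; rewrite addnC.
Qed.

End Spitzer.

(** * The mean maximal excess *)

Section Count.

Local Open Scope nat_scope.

Lemma card_ffun_preim (I : finType) k j (A : {set I}) : j <= k ->
  #|[set f : {ffun I -> 'I_k} | [set t | f t < j] == A]| =
  j ^ #|A| * (k - j) ^ (#|I| - #|A|).
Proof.
move=> jk.
pose F t : pred 'I_k := fun i => (i < j) == (t \in A).
rewrite (eq_card (B := family F)); last first.
  move=> f; rewrite inE; apply/eqP/familyP => [E t|H].
    by rewrite unfold_in /F -E finset.in_set.
  by apply/setP => t; rewrite inE; have := H t; rewrite unfold_in => /eqP.
have cj : #|[pred i : 'I_k | i < j]| = j.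
  by rewrite -sum1_card -(big_ord_widen _ (fun=> 1)) // sum_nat_const card_ord muln1.
rewrite card_family foldrE big_map big_enum /= (bigID (mem A)) /=; congr (_ * _).
  rewrite (eq_bigr (fun=> j)) => [|t tA]; first by rewrite prod_nat_const.
  by rewrite -[RHS]cj; apply: eq_card => i; rewrite unfold_in /F tA eqb_id.
rewrite (eq_bigr (fun=> k - j)) => [|t /negPf tA].
  by rewrite prod_nat_const -(cardC (mem A)) addKn; congr (_ ^ _); apply: eq_card.
have -> : k - j = #|predC [pred i : 'I_k | i < j]|.
  have := cardC [pred i : 'I_k | i < j]; rewrite cj card_ord => H.
  by rewrite -[X in X - j]H addKn.
by apply: eq_card => i; rewrite unfold_in /F tA eqbF_neg !inE.
Qed.

(** For uniform [f] the count is binomial with parameters [k] and [j / k]; the weights are [k ^ k]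
    times its probabilities. *)
Lemma sum_count_below k j (F : nat -> nat) : j <= k ->
  \sum_(f : {ffun 'I_k -> 'I_k}) F (count_below f j) =
  \sum_(b < k.+1) 'C(k, b) * (j ^ b * (k - j) ^ (k - b)) * F b.
Proof.
move=> jk.
rewrite (partition_big (fun f : {ffun 'I_k -> 'I_k} => [set t | f t < j]) predT) //=.
transitivity (\sum_(A : {set 'I_k}) j ^ #|A| * (k - j) ^ (k - #|A|) * F #|A|).
  apply: eq_bigr => A _; have := card_ffun_preim A jk; rewrite card_ord => <-.
  rewrite (eq_bigr (fun=> F #|A|)) => [|f /eqP <- //].
  by rewrite sum_nat_const; congr (_ * _); apply: eq_card => f; rewrite inE.
rewrite (partition_big (fun A : {set 'I_k} => inord #|A| : 'I_k.+1) predT) //=.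
apply: eq_bigr => b _.
have E (A : {set 'I_k}) : (inord #|A| == b) = (#|A| == b :> nat).
  by rewrite -val_eqE /= inordK // ltnS -[X in _ <= X]card_ord max_card.
rewrite (eq_bigl _ _ E) (eq_bigr (fun=> j ^ b * (k - j) ^ (k - b) * F b)).
  rewrite sum_nat_const mulnA; congr (_ * _ * _).
  by rewrite -[k in 'C(k, _)]card_ord -card_draws cardsE.
by move=> A /eqP ->.
Qed.

(* De Moivre's telescoping formula for the mean deviation of a binomial law. *)
Lemma sum_count_below_excess k j : j <= k ->
  k * (\sum_(f : {ffun 'I_k -> 'I_k}) (count_below f j - j)) =
  (k - j) * (j * ('C(k, j) * (j ^ j * (k - j) ^ (k - j)))).
Proof.
move=> jk; rewrite (sum_count_below (fun b => b - j)) //.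
pose W b := 'C(k, b) * (j ^ b * (k - j) ^ (k - b)).
have W0 : W k.+1 = 0 by rewrite /W bin_small.
(* [k * (W b * (b - j))] is the decrement of [(k - j) * (b * W b)] from [b] to [b.+1]; [W0] ends the
   telescope. *)
have step b : j <= b <= k ->
    k * (W b * (b - j)) + (k - j) * (b.+1 * W b.+1) = (k - j) * (b * W b).
  move=> /andP[jb]; rewrite leq_eqVlt => /orP[/eqP ->|bk]; first by rewrite W0; lia.
  have -> : (k - j) * (b.+1 * W b.+1) = (k - b) * j * W b.
    have kb : k - b = (k - b.+1).+1 by lia.
    transitivity (b.+1 * 'C(k, b.+1) * (j * j ^ b * ((k - j) * (k - j) ^ (k - b.+1)))).
      rewrite /W expnS; ring.
    rewrite mul_bin_left -[(k - j) * _]expnS -kb /W; ring.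
  have [c bE] : exists c, b = j + c by exists (b - j); lia.
  have [d kE] : exists d, k = b + d by exists (k - b); lia.
  have -> : b - j = c by lia.
  have -> : k - j = c + d by lia.
  have -> : k - b = d by lia.
  by move: (W b) => w; rewrite kE bE; ring.
have T n : j <= n -> n <= k.+1 ->
   k * (\sum_(j <= b < n) W b * (b - j)) + (k - j) * (n * W n) = (k - j) * (j * W j).
  elim: n => [|n IH] jn nk.
    by move: jn; rewrite leqn0 => /eqP ->; rewrite big_geq // muln0.
  move: jn; rewrite leq_eqVlt => /orP[/eqP <-|jn]; first by rewrite big_geq // muln0.
  rewrite big_nat_recr //= mulnDr -addnA step; last by apply/andP; split.
  by apply: IH => //; exact: ltnW.
have := T k.+1 (leqW jk) (leqnn _); rewrite W0 !muln0 addn0 => <-.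
rewrite -(big_mkord xpredT (fun b => W b * (b - j))) (@big_cat_nat _ _ _ j) //= ?leqW //.
rewrite big_nat_cond big1 ?add0n // => b /andP[/andP[_ bj] _].
by apply/eqP; rewrite muln_eq0 subn_eq0 (ltnW bj) orbT.
Qed.

(** Iterating Spitzer's step with De Moivre's formula gives the sum of [(k - j) * W j], where [W 0]
    supplies the term [j = 0]. As [W] is symmetric under [j |-> k - j], doubling turns the factor
    into [k]. *)
Lemma sum_max_excess k : 0 < k ->
  2 * (\sum_(f : {ffun 'I_k -> 'I_k}) max_excess k f) + 2 * k ^ k =
  \sum_(i < k.+1) k ^_ i * k ^ (k - i).
Proof.
move=> k0; pose W j := 'C(k, j) * (j ^ j * (k - j) ^ (k - j)).
have W0 : W 0 = k ^ k by rewrite /W bin0 expn0 subn0 !mul1n.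
have T n : n <= k -> k * (\sum_(f : {ffun 'I_k -> 'I_k}) max_excess n f + W 0) =
    \sum_(j < n.+1) (k - j) * W j.
  elim: n => [|n IH] nk.
    rewrite big1 ?big_ord1 ?subn0 // => f _; apply/eqP; rewrite -leqn0.
    apply/max_excess_leP => j; rewrite leqn0 => /eqP ->.
    by rewrite leqn0 cards_eq0; apply/eqP/setP => t; rewrite !inE.
  rewrite big_ord_recr /= -IH; last exact: ltnW.
  apply/eqP; rewrite -(eqn_pmul2l (ltn0Sn n)); apply/eqP.
  rewrite mulnCA mulnDr sum_max_excessS // [in RHS]mulnDr -[n.+1 * (_ * W _)]mulnCA.
  rewrite -(sum_count_below_excess nk); ring.
rewrite -sum_binomial_weights -W0 -mulnDr.
apply/eqP; rewrite -(eqn_pmul2l k0) mulnCA T //; apply/eqP.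
rewrite mul2n -addnn [X in X + _](reindex_inj rev_ord_inj) /= -big_split /=.
rewrite big_distrr /=; apply: eq_bigr => j _.
have jk : j <= k by rewrite -ltnS.
by rewrite /W subSS subKn // bin_sub // [_ ^ (k - j) * _]mulnC -mulnDl subnKC.
Qed.

End Count.

(** * Comparison with the Gaussian integral *)

Section Gauss.

Local Open Scope classical_set_scope.
Local Open Scope ring_scope.

Variable R : realType.
Local Notation mu := (@lebesgue_measure R).

Lemma gauss_fun_anti (x y : R) : 0 <= x -> x <= y -> gauss_fun y <= gauss_fun x.
Proof.
move=> x0 xy; rewrite ler_expR lerN2 ler_sqr ?nnegrE //.
exact: le_trans xy.
Qed.

(** A right-endpoint Riemann sum of a decreasing function lies below its integral. *)
Lemma riemann_gauss_le (s : R) n : 0 < s ->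
  \sum_(i < n) gauss_fun (i.+1%:R / s) / s <= Num.sqrt pi / 2.
Proof.
move=> s0; pose g (x : R) := (gauss_fun x)%:E.
have mg (D : set R) : measurable_fun D g.
  by apply/measurable_EFinP/measurable_funTS; exact: measurable_gauss_fun.
have g0 x : (0%R <= g x)%E by rewrite lee_fin gauss_fun_ge0.
suff H : ((\sum_(i < n) gauss_fun (i.+1%:R / s) / s)%:E <=
    \int[mu]_(x in `[0%R, (n%:R / s)%R]) g x)%E.
  rewrite -lee_fin -integral0y_gauss; apply: le_trans H _.
  apply: ge0_subset_integral => //; first exact: mg.
by move=> x /=; rewrite !in_itv /= andbT => /andP[].
elim: n => [|n IH].
  by rewrite big_ord0 integral_ge0.
have s1 : n%:R / s < n.+1%:R / s by rewrite ltr_pM2r ?invr_gt0 // ltr_nat.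
have n0 : 0 <= n%:R / s by rewrite divr_ge0 // ltW.
have -> : [set` `[0, n.+1%:R / s]] =
    [set` `[0, n%:R / s]] `|` [set` `]n%:R / s, n.+1%:R / s]] :> set R.
  by rewrite -itv_bndbnd_setU // bnd_simp // ltW.
rewrite ge0_integral_setU //; [|exact: mg|]; last first.
  apply/disj_setPLR => x /=; rewrite !in_itv /= => /andP[_ xs].
  by apply/negP; rewrite negb_and -leNgt xs.
rewrite big_ord_recr /= EFinD leeD //.
have -> : (gauss_fun (n.+1%:R / s) / s)%:E =
    (\int[mu]_(x in `](n%:R / s)%R, (n.+1%:R / s)%R]) cst (g (n.+1%:R / s)%R) x)%E.
  rewrite integral_cst //= lebesgue_measure_itv /= lte_fin s1 -EFinB -EFinM.
  by congr (_%:E); rewrite -mulrBl -natr1 [_ + 1]addrC addrK mul1r.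
apply: ge0_le_integral => //=; first exact: mg.
move=> x; rewrite in_itv /= => /andP[nx xn].
by rewrite lee_fin gauss_fun_anti // (le_trans n0) // ltW.
Qed.

(** The quotient by [k ^ i.+1] is the product of [1 - l / k] for [l <= i], and
    [1 - x <= expR (- x)]. *)
Lemma ffact_le_expR k i :
  (k ^_ i.+1)%:R <= k%:R ^+ i.+1 * expR (- (i%:R * i.+1%:R / 2) / k%:R) :> R.
Proof.
have [->|k0] := posnP k; first by rewrite ffact0n mulr_ge0 ?expR_ge0 // exprn_ge0.
have k0' : 0 < k%:R :> R by rewrite ltr0n.
elim: i => [|i IH]; first by rewrite ffactn1 !mul0r oppr0 mul0r expR0 mulr1.
rewrite ffactnSr natrM exprSr.
have E : expR (- (i.+1%:R * i.+2%:R / 2) / k%:R) =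
   expR (- (i%:R * i.+1%:R / 2) / k%:R) * expR (- (i.+1%:R / k%:R)) :> R.
  rewrite -expRD; congr expR; rewrite -[i.+2%:R]natr1 -[i.+1%:R]natr1.
  by field; rewrite gt_eqF.
rewrite E mulrACA; apply: ler_pM => //.
have [ki|ik] := leqP k i.+1.
  by move: ki; rewrite -subn_eq0 => /eqP ->; rewrite mulr_ge0 ?expR_ge0 // ltW.
rewrite natrB 1?ltnW // -ler_pdivrMl // mulrBr mulVf ?gt_eqF // [_^-1 * _]mulrC.
exact: expR_ge1Dx.
Qed.

Lemma sum_ffact_le k : (0 < k)%N ->
  (\sum_(i < k.+1) k ^_ i * k ^ (k - i))%N%:R <=
  (k ^ k)%:R * (2 + 2 * Num.sqrt (pi * k%:R / 8)) :> R.
Proof.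
move=> k0; have k0' : 0 < k%:R :> R by rewrite ltr0n.
(* With this scale [expR (- i ^ 2 / (2 k))] is [gauss_fun (i / s)]. The terms 0 and 1 of the sum
   account for the 2 in the bound, the others form the Riemann sum. *)
pose s : R := Num.sqrt (2 * k%:R).
have s0 : 0 < s by rewrite sqrtr_gt0 mulr_gt0.
have term i : (i < k)%N ->
    (k ^_ i.+1 * k ^ (k - i.+1))%:R <= (k ^ k)%:R * gauss_fun (i%:R / s) :> R.
  move=> ik; have le1 := ffact_le_expR k i.
  rewrite natrM; apply: (@le_trans _ _ ((k%:R ^+ i.+1 * gauss_fun (i%:R / s)) *
     (k ^ (k - i.+1))%:R)).
    rewrite ler_wpM2r //; apply: le_trans le1 _.
    rewrite ler_wpM2l ?exprn_ge0 // ler_expR mulNr lerN2 expr_div_n sqr_sqrtr; last first.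
      by rewrite mulr_ge0 // ltW.
    have -> : i%:R ^+ 2 / (2 * k%:R) = i%:R * i%:R / 2 / k%:R :> R.
      by field; rewrite gt_eqF.
    by rewrite !ler_pM2r ?invr_gt0 // ler_wpM2l // ler_nat.
  by rewrite mulrAC -natrX -natrM -expnD subnKC.
rewrite natr_sum big_ord_recl ffactn0 subn0 mul1n.
apply: (@le_trans _ _ ((k ^ k)%:R + \sum_(i < k) (k ^ k)%:R * gauss_fun (i%:R / s))).
  by rewrite lerD2l; apply: ler_sum => i _; rewrite lift0 term.
rewrite -mulr_sumr -{1}[_%:R]mulr1 -mulrDr ler_wpM2l //.
clear k0' term; case: k k0 @s s0 => // k _ s s0.
rewrite big_ord_recl mul0r /gauss_fun expr0n oppr0 expR0 -/(gauss_fun _) addrA lerD2l.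
rewrite (eq_bigr (fun i : 'I_k => gauss_fun (i.+1%:R / s) / s * s)) => [|i _]; last first.
  by rewrite divfK ?gt_eqF // /bump /= add1n.
rewrite -mulr_suml.
apply: le_trans (ler_wpM2r (ltW s0) (riemann_gauss_le k s0)) _.
rewrite mulrAC ler_pdivrMr // -sqrtrM ?pi_ge0 //.
have -> : pi * (2 * k.+1%:R) = 4 ^+ 2 * (pi * k.+1%:R / 8) :> R by field.
by rewrite sqrtrM ?sqr_ge0 // sqrtr_sqr ger0_norm //; lra.
Qed.

(** The [2 * k ^ k] of [sum_max_excess] cancels that of [sum_ffact_le], so no additive error
    remains. *)
Lemma mean_max_excess_le k : (0 < k)%N ->
  (\sum_(f : {ffun 'I_k -> 'I_k}) max_excess k f)%N%:R <=
  (k ^ k)%:R * Num.sqrt (pi * k%:R / 8) :> R.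
Proof.
move=> k0; have := sum_ffact_le k0; rewrite -sum_max_excess // natrD !natrM.
lra.
Qed.

End Gauss.

(** * Approximately optimal mixed strategies *)

Section Game.

Variables (R : realType) (T : finType) (A : T -> T -> R).
Hypothesis A_anti : forall a b, A a b = - A b a.
Hypothesis A_le1 : forall a b, `|A a b| <= 1.

Lemma max0D_sqr (x y : R) : `|y| <= 1 ->
  Num.max 0 (x + y) ^+ 2 <= Num.max 0 x ^+ 2 + 2 * (Num.max 0 x * y) + 1.
Proof.
rewrite ler_norml => /andP[y1 y2].
by case: (lerP 0 (x + y)) => ?; case: (lerP 0 x) => ?; nra.
Qed.

(* Regret matching: the response is chosen against the mixed strategy
   proportional to the positive parts of the current regrets, whose value is
   [0] by antisymmetry. *)
Lemma regret_matching_step (r : T -> R) : (0 < #|T|)%N -> (forall a, 0 <= r a) ->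
  exists b, \sum_a r a * A a b <= 0.
Proof.
move=> T0 r0.
(* The weighted mean of the sums vanishes, so they cannot all be positive unless [r = 0], when they
   are 0. *)
have tot : \sum_b r b * (\sum_a r a * A a b) = 0.
  have E : \sum_b r b * (\sum_a r a * A a b) = - \sum_b r b * (\sum_a r a * A a b).
    rewrite -[RHS]mulN1r [RHS]mulr_sumr.
    rewrite [RHS](eq_bigr (fun b => \sum_a r b * (r a * A b a))).
      rewrite exchange_big /=; apply: eq_bigr => b _.
      by rewrite mulr_sumr; apply: eq_bigr => a _; ring.
    by move=> b _; rewrite !mulr_sumr; apply: eq_bigr => a _; rewrite (A_anti a); ring.
  by lra.
case: (pickP (fun b => \sum_a r a * A a b <= 0)) => [b Hb|H]; first by exists b.
have pos b : 0 < \sum_a r a * A a b by rewrite ltNge H.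
have z b : r b = 0.
  have /eqP := tot; rewrite psumr_eq0 => [/allP /(_ b)|c _]; last first.
    by rewrite mulr_ge0 // ltW.
  by rewrite mem_index_enum mulf_eq0 (gt_eqF (pos b)) orbF => /(_ isT) /eqP.
have /card_gt0P[b _] := T0.
by have := pos b; rewrite big1 ?ltxx // => a _; rewrite z mul0r.
Qed.

(** The potential, the sum of squared positive regrets, grows by at most [#|T|] per round, since the
    response makes the cross term nonpositive. *)
Lemma regret_matching N : (0 < #|T|)%N ->
  exists2 s : seq T, size s = N &
    forall a, Num.max 0 (\sum_(b <- s) A a b) ^+ 2 <= N%:R * #|T|%:R.
Proof.
move=> T0.
suff [s sN H] : exists2 s : seq T, size s = N &
    \sum_a Num.max 0 (\sum_(b <- s) A a b) ^+ 2 <= N%:R * #|T|%:R.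
  exists s => // a; apply: le_trans H.
  by rewrite (bigD1 a) //= lerDl sumr_ge0 // => b _; rewrite sqr_ge0.
elim: N => [|N [s sN IH]].
  by exists [::] => //; rewrite mul0r big1 // => a _; rewrite big_nil maxxx expr0n.
have [|b Hb] := @regret_matching_step (fun a => Num.max 0 (\sum_(b <- s) A a b)) T0.
  by move=> a; rewrite le_max lexx.
exists (b :: s); first by rewrite /= sN.
apply: (@le_trans _ _ (\sum_a (Num.max 0 (\sum_(b <- s) A a b) ^+ 2 +
   2 * (Num.max 0 (\sum_(b <- s) A a b) * A a b) + 1))).
  by apply: ler_sum => a _; rewrite big_cons addrC max0D_sqr.
rewrite !big_split /= -mulr_sumr sumr_const -natr1 mulrDl mul1r.
by lra.
Qed.

End Game.

(** * Pools against which no candidate gets much more than half *)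

Section Election.

Variables (R : realType) (E : election).
Implicit Types a b : candidate E.
Local Notation p := (pref_frac R).

Lemma prefers_asym (v : voter E) a b : a != b -> prefers v b a = ~~ prefers v a b.
Proof.
move=> ab; have [irr tr tot] := prefersP v.
apply/idP/idP => [ba|]; last by have := tot a b ab; case: (prefers v a b).
by apply/negP => H; have := tr _ _ _ ba H; rewrite irr.
Qed.

Lemma pref_fracC a b : a != b -> p a b + p b a = 1.
Proof.
move=> ab; rewrite -mulrDr -big_split /=.
rewrite (eq_bigr (fun=> 1)) => [|v _]; last first.
  by rewrite [prefers v b a]prefers_asym //; case: prefers; rewrite ?addr0 ?add0r.
rewrite sumr_const mulVf // pnatr_eq0 -lt0n.
exact: voter_gt0.
Qed.

Lemma pref_frac_ge0 a b : 0 <= p a b.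
Proof. by rewrite mulr_ge0 ?invr_ge0 ?ler0n // sumr_ge0. Qed.

Lemma pref_fracxx a : p a a = 0.
Proof.
rewrite /pref_frac big1 ?mulr0 // => v _.
by have [irr _ _] := prefersP v; rewrite irr.
Qed.

(** Regret matching for the vote margin. The length is a multiple of [k] so that the ranks later
    split into [k] equal blocks. *)
Lemma approx_balanced (d : R) (k : nat) : 0 < d -> (0 < k)%N ->
  exists L, (0 < L)%N /\ exists c : 'I_(k * L) -> candidate E,
    forall a, \sum_i p a (c i) <= (1 / 2 + d) * (k * L)%:R.
Proof.
move=> d0 k0.
pose A a b := p a b - p b a.
have A1 a b : `|A a b| <= 1.
  have [->|ab] := eqVneq a b; first by rewrite /A subrr normr0.
  have := pref_fracC ab; have := pref_frac_ge0 a b; have := pref_frac_ge0 b a.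
  by rewrite /A ler_norml => ? ? ?; apply/andP; split; lra.
(* Equality unless [a = b], where the left side is 0. *)
have pA a b : p a b <= 1 / 2 + A a b / 2.
  have [->|ab] := eqVneq a b; first by rewrite /A pref_fracxx; lra.
  by have := pref_fracC ab; rewrite /A; lra.
(* Chosen so that the regret bound [sqrt (N * #|C|)] is at most [2 * d * N] for every [N >= L]. *)
pose L := (Num.bound (#|candidate E|%:R / (4 * d ^+ 2))).+1.
have LP : #|candidate E|%:R <= 4 * d ^+ 2 * L%:R.
  rewrite mulrC -ler_pdivrMr; last by rewrite mulr_gt0 // exprn_gt0.
  apply/ltW/(lt_le_trans (archi_boundP _)).
    by rewrite divr_ge0 // mulr_ge0 // sqr_ge0.
  by rewrite ler_nat.
exists L; split => //.
have [|s sN H] := @regret_matching R _ A _ A1 (k * L) (candidate_gt0 E).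
  by move=> a b; rewrite /A; ring.
exists (tnth (Tuple (introT eqP sN))) => a.
rewrite -(big_tuple _ _ (Tuple (introT eqP sN)) xpredT (p a)) /=.
have Ha := H a.
set N := (k * L)%N in Ha *.
have LN : (L <= N)%N by rewrite leq_pmull.
have rN : \sum_(b <- s) A a b <= 2 * d * N%:R.
  apply: (@le_trans _ _ (Num.max 0 (\sum_(b <- s) A a b))).
    by rewrite le_max lexx orbT.
  rewrite -ler_sqr ?nnegrE ?le_max ?lexx //; last by rewrite !mulr_ge0 // ltW.
  apply: le_trans Ha _.
  have N0 : 0 <= N%:R :> R by [].
  have LN' : L%:R <= N%:R :> R by rewrite ler_nat.
  have -> : (2 * d * N%:R) ^+ 2 = N%:R * (4 * d ^+ 2 * N%:R) by ring.
  apply: ler_wpM2l => //; apply: le_trans LP _; apply: ler_wpM2l => //.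
  by rewrite mulr_ge0 // sqr_ge0.
apply: (@le_trans _ _ (\sum_(b <- s) (1 / 2 + A a b / 2))).
  exact: ler_sum.
rewrite big_split /= -!mulr_suml big_const_seq count_predT sN iter_addr_0.
rewrite -[_ *+ (k * L)]mulr_natr.
rewrite -/N; move: rN; move: (N%:R : R) (\sum_(b <- s) A a b) => x y; lra.
Qed.

End Election.

(** * Sampling *)

Section Rank.

Local Open Scope nat_scope.

Variables (T : finType) (r : rel T) (N : nat) (c : 'I_N -> T).
Hypothesis rP : strict_linear_order r.

(* Ties [c i = c i'] are broken by the index. *)
Definition ranked_below (i' i : 'I_N) :=
  r (c i) (c i') || (c i == c i') && (i' < i).

Definition rank i := #|[set i' | ranked_below i' i]|.

Lemma ranked_below_irr i : ranked_below i i = false.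
Proof. by have [irr _ _] := rP; rewrite /ranked_below irr ltnn andbF. Qed.

Lemma ranked_below_trans : transitive ranked_below.
Proof.
have [_ tr _] := rP; move=> y x z /orP[yx|/andP[/eqP yx xy]] /orP[zy|/andP[/eqP zy yz]].
- by rewrite /ranked_below (tr _ _ _ zy yx).
- by rewrite /ranked_below zy yx.
- by rewrite /ranked_below -yx zy.
- by rewrite /ranked_below zy yx eqxx (ltn_trans xy yz) orbT.
Qed.

Lemma rank_mono i i' : ranked_below i' i -> rank i' < rank i.
Proof.
move=> lt_i; apply/proper_card/properP; split.
  by apply/fintype.subsetP => j; rewrite !inE => /ranked_below_trans; apply.
by exists i'; rewrite !inE ?ranked_below_irr.
Qed.

Lemma rank_inj : injective rank.
Proof.
move=> i i' E; apply/eqP/negPn/negP => ii'.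
have /orP[] : ranked_below i i' || ranked_below i' i.
  have [_ _ tot] := rP; rewrite /ranked_below.
  have [cc|cc] := eqVneq (c i) (c i').
    rewrite cc ?eqxx /=; case: (ltngtP i i'); rewrite ?orbT // => /val_inj iE.
    by rewrite iE eqxx in ii'.
  by have := tot _ _ cc; case: (r (c i) (c i')); rewrite ?orbT //= => ->.
all: by move/rank_mono; rewrite E ltnn.
Qed.

Lemma rank_lt i : rank i < N.
Proof.
rewrite -[X in _ < X]card_ord -cardsT; apply/proper_card/properP; split => //.
by exists i; rewrite !inE ?ranked_below_irr.
Qed.

Definition rank_ord i : 'I_N := Ordinal (rank_lt i).

Lemma rank_ord_inj : injective rank_ord.
Proof. by move=> i i' /(congr1 val) /rank_inj. Qed.

Definition rank_perm : {perm 'I_N} := perm rank_ord_inj.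

(** By transitivity [a] also beats all that is ranked below [i]. Thus what [a] beats occupies the
    lowest ranks, in a ranking independent of [a]. *)
Lemma rank_perm_lt a i : r a (c i) -> rank_perm i < #|[set i' | r a (c i')]|.
Proof.
have [_ tr _] := rP; move=> ai; rewrite permE /=.
apply/proper_card/properP; split.
  apply/fintype.subsetP => j; rewrite !inE => /orP[|/andP[/eqP <- //]]; exact: tr.
by exists i; rewrite !inE ?ranked_below_irr.
Qed.

End Rank.

(** * Rounding ranks to equal blocks *)

Section Blocks.

Local Open Scope nat_scope.

Variables (k L : nat).
Hypothesis L0 : 0 < L.

Lemma block_lt (x : 'I_(k * L)) : x %/ L < k.
Proof. by rewrite ltn_divLR. Qed.

Definition block (x : 'I_(k * L)) : 'I_k := Ordinal (block_lt x).

Lemma card_block b : #|[pred x | block x == b]| = L.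
Proof.
have lt_h (x : 'I_L) : b * L + x < k * L.
  apply: (@leq_trans (b.+1 * L)); first by rewrite mulSnr ltn_add2l.
  by rewrite leq_mul2r ltn_ord orbT.
pose h x := Ordinal (lt_h x).
have h_inj : injective h.
  by move=> x y /(congr1 val) /= /addnI /val_inj.
rewrite -[RHS](card_ord L) -(card_codom h_inj); apply: eq_card => x.
rewrite !inE -val_eqE /=; apply/eqP/codomP => [xb|[y ->]] /=; last first.
  by rewrite divnMDl // divn_small ?addn0.
exists (Ordinal (ltn_pmod x L0)); apply: val_inj => /=.
by rewrite -xb -divn_eq.
Qed.

Definition block_fun (I : finType) (g : {ffun I -> 'I_(k * L)}) : {ffun I -> 'I_k} :=
  [ffun t => block (g t)].

(** Blocks have equal size, so a uniform [g] induces a uniform [f]. *)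
Lemma sum_block_fun (I : finType) (F : {ffun I -> 'I_k} -> nat) :
  \sum_g F (block_fun g) = L ^ #|I| * \sum_f F f.
Proof.
rewrite (partition_big (@block_fun I) predT) //= big_distrr /=; apply: eq_bigr => f _.
rewrite (eq_bigr (fun=> F f)) => [|g /eqP -> //].
rewrite sum_nat_const; congr (_ * _).
rewrite (eq_card (B := family (fun t => [pred x | block x == f t]))); last first.
  move=> g; transitivity (block_fun g == f); first by [].
  apply/idP/familyP => [/eqP gf t|H].
    by rewrite !inE -gf ffunE.
  by apply/eqP/ffunP => t; have := H t; rewrite !inE ffunE => /eqP.
rewrite card_family foldrE big_map big_enum /= (eq_bigr (fun=> L)) => [|t _].
  by rewrite prod_nat_const.
exact: card_block.
Qed.

(** Beaten sample points have rank below [J], hence lie in the first [J %/ L + 1] blocks; the extra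
    block costs the summand [L]. *)
Lemma card_sample_le (T : finType) (r : rel T) (rP : strict_linear_order r)
    (c : 'I_(k * L) -> T) (g : {ffun 'I_k -> 'I_(k * L)}) a :
  L * #|[set t | r a (c (g t))]| <=
  #|[set i | r a (c i)]| + L +
    L * max_excess k (block_fun (permute (rank_perm c rP) g)).
Proof.
set J := #|[set i : 'I_(k * L) | r a (c i)]|; set f := block_fun _.
have le_j : #|[set t | r a (c (g t))]| <= count_below f (J %/ L).+1.
  apply/subset_leq_card/fintype.subsetP => t; rewrite !inE => /(rank_perm_lt rP).
  rewrite !ffunE /= ltnS -/J => /ltnW; apply: leq_div2r.
have JL : L * (J %/ L) <= J by rewrite mulnC leq_trunc_div.
(* Otherwise [a] beats the whole pool, and the trivial bound [L * k <= J] suffices. *)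
have [jk|kj] := leqP (J %/ L).+1 k.
  have := leq_trans le_j (max_excess_ge f jk).
  rewrite -(leq_pmul2l L0) => /leq_trans; apply.
  by rewrite mulnDr mulnS leq_add2r addnC leq_add2r.
apply: (@leq_trans (L * k)).
  by rewrite leq_pmul2l // -[X in _ <= X](card_ord k) max_card.
rewrite -addnA; apply: leq_trans (leq_addr _ _); apply: leq_trans JL.
by rewrite leq_pmul2l.
Qed.

End Blocks.

Lemma exists_le_mean (R : realType) (T : finType) (F : T -> R) (x : R) :
  (0 < #|T|)%N -> \sum_t F t <= #|T|%:R * x -> exists t, F t <= x.
Proof.
move=> T0 le_x; case: (pickP (fun t => F t <= x)) => [t Ht|H]; first by exists t.
suff : #|T|%:R * x < \sum_t F t by rewrite ltNge le_x.
rewrite mulr_natl -sumr_const; apply: ltr_sum => [|t _]; last by rewrite ltNge H.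
by have /card_gt0P[t _] := T0; apply/hasP; exists t; rewrite ?mem_index_enum.
Qed.

(** * One sample for all candidates *)

Section Sampling.

Variables (R : realType) (E : election) (k L : nat).
Hypotheses (k0 : (0 < k)%N) (L0 : (0 < L)%N).
Variable c : 'I_(k * L) -> candidate E.

(** Each voter's permutation preserves the uniform law, so every [M v] has the same mean. A [g]
    whose total over the voters is at most average serves all [a], as [M] does not involve [a]. *)
Lemma exists_sample : exists g : {ffun 'I_k -> 'I_(k * L)}, forall a,
  L%:R * \sum_t pref_frac R a (c (g t)) <=
  \sum_i pref_frac R a (c i) + L%:R * (1 + Num.sqrt (pi * k%:R / 8)).
Proof.
set s : R := Num.sqrt _.
pose G := {ffun 'I_k -> 'I_(k * L)}.
pose M (v : voter E) (g : G) :=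
  max_excess k (block_fun L0 (permute (rank_perm c (prefersP v)) g)).
have n0 : 0 < #|voter E|%:R :> R by rewrite ltr0n voter_gt0.
have sumM v : (\sum_g M v g = L ^ k * \sum_(f : {ffun 'I_k -> 'I_k}) max_excess k f)%N.
  rewrite (sum_permute (rank_perm c (prefersP v))
    (fun g => max_excess k (block_fun L0 g))).
  by rewrite sum_block_fun card_ord.
have [||g Hg] := @exists_le_mean R G (fun g => (\sum_v M v g)%N%:R) (#|voter E|%:R * s).
- by rewrite card_ffun !card_ord expn_gt0 muln_gt0 k0 L0.
- rewrite -natr_sum exchange_big /= (eq_bigr _ (fun v _ => sumM v)) sum_nat_const.
  rewrite card_ffun !card_ord expnMn !natrM.
  have := mean_max_excess_le R k0; rewrite -/s => H.
  apply: (@le_trans _ _ (#|voter E|%:R * ((L ^ k)%:R * ((k ^ k)%:R * s)))).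
    by rewrite !ler_wpM2l.
  by rewrite le_eqVlt; apply/orP; left; apply/eqP; ring.
exists g => a.
have P (I : finType) (h : I -> candidate E) :
    \sum_i pref_frac R a (h i) =
    #|voter E|%:R^-1 * (\sum_v #|[set i | prefers v a (h i)]|)%N%:R.
  rewrite -mulr_sumr exchange_big /= natr_sum; congr (_ * _).
  apply: eq_bigr => v _; rewrite -natr_sum -sum1dep_card [in RHS]big_mkcond; congr (_%:R).
rewrite !P mulrCA -ler_pdivlMl ?invr_gt0 // invrK mulrDr mulVKf ?gt_eqF //.
have : (L * (\sum_v #|[set t | prefers v a (c (g t))]|) <=
   \sum_v #|[set i | prefers v a (c i)]| + #|voter E| * L + L * \sum_v M v g)%N.
  rewrite -sum_nat_const !big_distrr -!big_split /=; apply: leq_sum => v _.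
  exact: card_sample_le.
rewrite -(ler_nat R) !natrD !natrM => /le_trans; apply.
have := ler_wpM2l (ler0n R L) Hg; lra.
Qed.

End Sampling.

(** * Small dominating sets *)

(** [D] is the empirical distribution of [w]. An undominated [a] would get more than [1 / 2 + eps]
    against every member of [S], contradicting the expectation bound. *)
Lemma dominating_of_sample (R : realType) (E : election) (eps : R) (k : nat)
    (w : 'I_k -> candidate E) : (0 < k)%N ->
    (forall a, \sum_t pref_frac R a (w t) <= (1 / 2 + eps) * k%:R) ->
  exists S : {set candidate E},
    [/\ (#|S| <= k)%N, dominating_set (1 / 2 - eps) S &
        exists D : {ffun candidate E -> R},
          is_distr_over S D /\
          forall a : candidate E,
            expectation_over S D (fun b => pref_frac R a b) <= 1 / 2 + eps].
Proof.
move=> kN Hw; have k0 : 0 < k%:R :> R by rewrite ltr0n.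
pose S := [set w t | t : 'I_k].
pose D : {ffun candidate E -> R} := [ffun b => #|[set t | w t == b]|%:R / k%:R].
have ES f : expectation_over S D f = (\sum_t f (w t)) / k%:R.
  rewrite [in RHS](partition_big w (mem S)) /=; last first.
    by move=> t _; apply: imset_f.
  rewrite mulr_suml; apply: eq_bigr => b _.
  rewrite (eq_bigr (fun=> f b)) => [|t /eqP -> //].
  rewrite ffunE sumr_const -[f b *+ _]mulr_natl mulrAC; congr (_%:R * _ / _).
  by apply: eq_card => t; rewrite inE.
have ED a : expectation_over S D (fun b => pref_frac R a b) <= 1 / 2 + eps.
  by rewrite ES ler_pdivrMr.
have sumD : \sum_(b in S) D b = 1.
  have := ES (fun=> 1); rewrite sumr_const card_ord divff ?gt_eqF // => <-.
  by apply: eq_bigr => b _; rewrite mulr1.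
have D0 b : 0 <= D b by rewrite ffunE divr_ge0 // ltW.
exists S; split.
- by rewrite -[X in (_ <= X)%N](card_ord k) leq_imset_card.
- move=> a aS; apply/exists_inP; apply: contraT; rewrite negb_exists_in => /forall_inP H.
  have := ED a; rewrite leNgt => /negP; case.
  have lt_p b : b \in S -> 1 / 2 + eps < pref_frac R a b.
    move=> bS; have ab : a != b by apply: contraNneq aS => ->.
    by have := pref_fracC R ab; have := H b bS; rewrite -ltNge; lra.
  have [b bS Db] : exists2 b, b \in S & 0 < D b.
    exists (w (Ordinal kN)); first exact: imset_f.
    rewrite ffunE divr_gt0 // ltr0n card_gt0; apply/set0Pn.
    by exists (Ordinal kN); rewrite inE.
  have -> : 1 / 2 + eps = \sum_(i in S) D i * (1 / 2 + eps).
    by rewrite -mulr_suml sumD [RHS]mul1r.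
  rewrite /expectation_over (bigD1 b) //= [ltRHS](bigD1 b) //=.
  rewrite ltr_leD // ?ltr_pM2l ?lt_p //.
  by apply: ler_sum => i /andP[iS _]; rewrite ler_wpM2l // ltW // lt_p.
- exists D; split => //; split => // b bS.
  rewrite ffunE eq_card0 ?mul0r // => t; rewrite !inE.
  by apply/negP => /eqP wb; rewrite -wb imset_f in bS.
Qed.

(** With [d = 1 / k], balancing and rounding each cost 1 per sample, so
    [sqrt (pi * k / 8) + 2 <= k * eps] is needed; it follows by squaring. *)
Lemma exists_small_support (R : realType) (E : election) (eps : R) (k : nat) :
  0 < eps -> (0 < k)%N -> pi / 8 + 4 * eps <= k%:R * eps ^+ 2 ->
  exists w : 'I_k -> candidate E,
    forall a, \sum_t pref_frac R a (w t) <= (1 / 2 + eps) * k%:R.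
Proof.
move=> e0 k0 ke.
have k1 : 0 < k%:R :> R by rewrite ltr0n.
have d0 : 0 < k%:R^-1 :> R by rewrite invr_gt0.
have [L [L0 [c Hc]]] := approx_balanced E d0 k0.
have [g Hg] := exists_sample R k0 L0 c.
exists (fun t => c (g t)) => a.
have L1 : 0 < L%:R :> R by rewrite ltr0n.
have pi0 := pi_ge0 R.
have s_le : Num.sqrt (pi * k%:R / 8) <= k%:R * eps - 2.
  have k2 : 0 <= k%:R * eps - 2 by nra.
  rewrite -ler_sqr ?nnegrE ?sqrtr_ge0 // sqr_sqrtr; last first.
    by rewrite divr_ge0 // mulr_ge0 // ltW.
  nra.
rewrite -(ler_pM2l L1); apply: le_trans (Hg a) _.
have := ler_wpM2l (ltW L1) s_le; have := Hc a; rewrite natrM.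
have -> : (1 / 2 + k%:R^-1) * (k%:R * L%:R) = k%:R * L%:R / 2 + L%:R :> R.
  by field; rewrite gt_eqF.
rewrite !mulrDr mulr1; lra.
Qed.

(** The term [4 / eps] pays for balancing and rounding and is of lower order. *)
Definition sample_size (R : realType) (eps : R) : nat :=
  (Num.trunc (pi / (8 * eps ^+ 2) + 4 / eps)).+1.

Lemma sample_size_gt (R : realType) (eps : R) : 0 < eps ->
  pi / 8 + 4 * eps <= (sample_size eps)%:R * eps ^+ 2.
Proof.
move=> e0.
have : pi / (8 * eps ^+ 2) + 4 / eps < (sample_size eps)%:R.
  exact: truncnS_gt.
rewrite -(ltr_pM2r (exprn_gt0 2 e0)) => /ltW; apply: le_trans.
by rewrite le_eqVlt; apply/orP; left; apply/eqP; field; rewrite gt_eqF.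
Qed.

Lemma sample_size_le (R : realType) (eps : R) : 0 < eps ->
  (sample_size eps)%:R <= pi / (8 * eps ^+ 2) + 4 / eps + 1.
Proof.
move=> e0; rewrite /sample_size -natr1 lerD2r truncn_le //.
by rewrite addr_ge0 // divr_ge0 ?pi_ge0 // ?mulr_ge0 ?sqr_ge0 // ltW.
Qed.

(** * Asymptotics of the sample size *)

Local Open Scope classical_set_scope.

Lemma relative_sample_size_cvg (R : realType) :
  (sample_size x)%:R * (8 * x ^+ 2 / pi) - 1 @[x --> 0^'+] --> (0 : R).
Proof.
have pi0 := pi_gt0 R.
(* The upper bound is [4 / x + 1] multiplied by [8 * x ^ 2 / pi]. *)
apply: (@squeeze_cvgr _ _ _ _ (fun=> 0) (fun x => (32 * x + 8 * (x * x)) / pi)).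
- near=> x.
  have x0 : 0 < x by [].
  have x2 : 0 < 8 * x ^+ 2 / pi by rewrite divr_gt0 // mulr_gt0 // exprn_gt0.
  apply/andP; split.
    rewrite subr_ge0 -ler_pdivrMr //.
    have := sample_size_gt x0; rewrite -ler_pdivrMr ?exprn_gt0 //; apply: le_trans.
    have -> : (pi / 8 + 4 * x) / x ^+ 2 = 1 / (8 * x ^+ 2 / pi) + 4 / x :> R.
      by move: (pi : R) pi0 => q q0; field; rewrite !gt_eqF.
    by rewrite lerDl divr_ge0 // ltW.
  rewrite lerBlDr; apply: le_trans (ler_wpM2r (ltW x2) (sample_size_le x0)) _.
  rewrite le_eqVlt; apply/orP; left; apply/eqP.
  by move: (pi : R) pi0 => q q0; field; rewrite !gt_eqF.
- exact: cvg_cst.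
- apply: cvg_at_right_filter.
  have : (32 * x + 8 * (x * x)) / pi @[x --> (0 : R)] -->
      ((32 * 0 + 8 * (0 * 0)) / pi : R).
    apply: cvgM; last exact: cvg_cst.
    apply: cvgD; (apply: cvgM; first exact: cvg_cst); first exact: cvg_id.
    by apply: cvgM; exact: cvg_id.
  by rewrite !mulr0 addr0 mul0r.
Unshelve. all: end_near. Qed.

Theorem theorem1 (R : realType) :
  exists h : R -> R,
    h x @[x --> 0^'+] --> (0 : R) /\
    forall (eps : R) (E : election), 0 < eps ->
      exists S : {set candidate E},
        [/\ #|S|%:R <= (1 + h eps) * (pi / (8 * eps ^+ 2)),
            dominating_set (1 / 2 - eps) S &
            exists D : {ffun candidate E -> R},
              is_distr_over S D /\
              forall a : candidate E,
                expectation_over S D (fun b => pref_frac R a b)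
                  <= 1 / 2 + eps].
Proof.
(* This [h] makes the claimed bound equal to [sample_size eps]. *)
exists (fun x => (sample_size x)%:R * (8 * x ^+ 2 / pi) - 1).
split=> [|eps E e0]; first exact: relative_sample_size_cvg.
have [w Hw] := exists_small_support E e0 (ltn0Sn _) (sample_size_gt e0).
have [S [Sk domS [D HD]]] := dominating_of_sample (ltn0Sn _) Hw.
exists S; split=> //; last by exists D.
rewrite [X in _ <= X](_ : _ = (sample_size eps)%:R) ?ler_nat //.
by move: (pi : R) (pi_gt0 R) => q q0; field; rewrite !gt_eqF.
Qed.
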